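(* Fix a partition $\lambda=(\lambda_1\ge\dots\ge\lambda_n=0)$. The set of ice models $\mathcal{M}(\lambda)$, together with the maps $\tilde e_i,\tilde f_i,\mathrm{wt},\varepsilon_i,\varphi_i$, $i\in I$, is a (semiregular $\mathfrak{sl}_n$-)crystal.
   Context: Setting. $n$ is a positive integer, $\lambda=(\lambda_1\ge\dots\ge\lambda_n=0)$ is a partition (weakly decreasing integers, last part $0$), $s=\lambda_1+n$, $I=\{1,\dots,n-1\}$, $\mathbb{N}=\{0,1,2,\dots\}$. Ice models. An $n\times s$ ice model $M$ is a rectangular lattice with $n$ rows and $s$ columns of vertices and a sign ($+$ or $-$) on each edge adjacent to a vertex (including the boundary edges). Columns are numbered $1,\dots,s$ from left to right; rows are numbered $n,n-1,\dots,1$ from top to bottom (row $1$ is the bottom row). $M_{i,j}$ is the vertex in row $i$, column $j$, and $M_{i,j}^{\uparrow},M_{i,j}^{\leftarrow},M_{i,j}^{\rightarrow},M_{i,j}^{\downarrow}$ are the signs on its top, left, right, bottom edges; thus $M_{i,j}^{\rightarrow}=M_{i,j+1}^{\leftarrow}$ and $M_{i+1,j}^{\downarrow}=M_{i,j}^{\uparrow}$. The valid vertex configurations, written $(\uparrow,\leftarrow,\rightarrow,\downarrow)$, are: type 1 $(+,+,+,+)$; type 2 $(+,-,-,+)$; type 3 $(+,-,+,-)$; type 4 $(-,+,-,+)$; type 5 $(-,-,-,-)$. A 5-vertex ice model is one all of whose vertices are valid. $\mathcal{M}(\lambda)$ is the set of $n\times s$ 5-vertex ice models $M$ with: $M_{n,q}^{\uparrow}=-$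 iff $q=\lambda_1+j-\lambda_j$ for some $j\in\{1,\dots,n\}$; $M_{p,1}^{\leftarrow}=+$ for $1\le p\le n$; $M_{1,q}^{\downarrow}=+$ for $1\le q\le s$; $M_{p,s}^{\rightarrow}=-$ for $1\le p\le n$. Boxes. $\beta(M)$ is the set of $(p,q)$, $1\le p\le n$, $1\le q\le s$, with $M_{p,q}$ of type 2; its elements are the boxes of $M$. Signatures. For $i\in I$, list the boxes $(p,q)\in\beta(M)$ with $p\in\{i,i+1\}$ in increasing order for $(p,q)\preceq(p',q')\iff q<q'$ or ($q=q'$ and $p\le p'$), and write the letter $\mathsf L$ for a box in row $i$ and $\mathsf R$ for a box in row $i+1$. The resulting word is the $i$-signature $\sigma_i(M)$. The reduced $i$-signature $\sigma_i^{\mathrm{red}}(M)$ is obtained by repeatedly deleting (adjacent) subwords $\mathsf L\mathsf R$ until a word $\mathsf R^{a}\mathsf L^{b}$ remains; each surviving letter corresponds to a box. Crystal operators $\tilde f_i,\tilde e_i:\mathcal{M}(\lambda)\to\mathcal{M}(\lambda)\cup\{0\}$. If $\mathsf L$ does not occur in $\sigma_i^{\mathrm{red}}(M)$, $\tilde f_i(M)=0$. Otherwise let $(i,q)$ be the box of the first $\mathsf L$ in $\sigma_i^{\mathrm{red}}(M)$; then $q\ge2$, the edge signs $M_{i+1,q-1}^{\rightarrow},M_{i,q-1}^{\rightarrow},M_{i,q-1}^{\uparrow},M_{i,q}^{\uparrow}$ (the four interior edges of the $2\times2$ block in rows $i,i+1$ and columns $q-1,q$) are $+,-,-,+$ respectively,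 and $\tilde f_i(M)$ is $M$ with these four signs replaced by $-,+,+,-$ and all other signs unchanged. If $\mathsf R$ does not occur in $\sigma_i^{\mathrm{red}}(M)$, $\tilde e_i(M)=0$. Otherwise let $(i+1,q)$ be the box of the last $\mathsf R$ in $\sigma_i^{\mathrm{red}}(M)$; then $q+1\le s$, the signs $M_{i+1,q}^{\rightarrow},M_{i,q}^{\rightarrow},M_{i,q}^{\uparrow},M_{i,q+1}^{\uparrow}$ are $-,+,+,-$ respectively, and $\tilde e_i(M)$ is $M$ with these replaced by $+,-,-,+$ and all other signs unchanged. (In each case the result again lies in $\mathcal{M}(\lambda)$.) Weights. $P=\big(\bigoplus_{i=1}^n\mathbb{Z}\epsilon_i\big)/\mathbb{Z}(\epsilon_1+\dots+\epsilon_n)$ is the weight lattice of $\mathfrak{sl}_n$, where $\epsilon_i$ reads the $i$-th diagonal entry; $\alpha_i=\epsilon_i-\epsilon_{i+1}$; $h_i=E_{i,i}-E_{i+1,i+1}$, so $\langle h_i,\epsilon_j\rangle=\delta_{i,j}-\delta_{i+1,j}$. $\mathrm{wt}:\mathcal{M}(\lambda)\to P$ is $\mathrm{wt}(M)=\sum_{i=1}^n a_i^M\epsilon_i$, $a_i^M=|\{(p,q)\in\beta(M):p=i\}|$. Crystals. A semiregular $\mathfrak{sl}_n$-crystal is a set $\mathcal{B}$ with maps $\mathrm{wt}:\mathcal{B}\to P$ and $\tilde e_i,\tilde f_i:\mathcal{B}\to\mathcal{B}\cup\{0\}$ ($i\in I$) such that, with $\varepsilon_i(b)=\max\{k\in\mathbb{N}:\tilde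 e_i^k(b)\in\mathcal{B}\}$ and $\varphi_i(b)=\max\{k\in\mathbb{N}:\tilde f_i^k(b)\in\mathcal{B}\}$ (both being well-defined elements of $\mathbb{N}$), for all $b,b'\in\mathcal{B}$, $i\in I$: (C1) $\varphi_i(b)=\varepsilon_i(b)+\langle h_i,\mathrm{wt}(b)\rangle$; (C2) $\mathrm{wt}(\tilde e_i(b))=\mathrm{wt}(b)+\alpha_i$ when $\tilde e_i(b)\in\mathcal{B}$; (C3) $\mathrm{wt}(\tilde f_i(b))=\mathrm{wt}(b)-\alpha_i$ when $\tilde f_i(b)\in\mathcal{B}$; (C4) $\varepsilon_i(\tilde e_i(b))=\varepsilon_i(b)-1$ and $\varphi_i(\tilde e_i(b))=\varphi_i(b)+1$ when $\tilde e_i(b)\in\mathcal{B}$; (C5) $\varepsilon_i(\tilde f_i(b))=\varepsilon_i(b)+1$ and $\varphi_i(\tilde f_i(b))=\varphi_i(b)-1$ when $\tilde f_i(b)\in\mathcal{B}$; (C6) $\tilde f_i(b)=b'$ if and only if $b=\tilde e_i(b')$. On $\mathcal{M}(\lambda)$, $\varepsilon_i,\varphi_i$ are defined by these formulas. *)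

(* Defs.v *)
From HB Require Import structures.
From mathcomp Require Import all_boot all_order all_algebra.
Set Implicit Arguments.
Unset Strict Implicit.
Unset Printing Implicit Defensive.
Import GRing.Theory.

Local Open Scope quotient_scope.

(* Rows, columns and the index set I are 0-based: row p + 1 is p : 'I_n (the
   bottom row is 0), and the element i + 1 of {1, ..., n - 1} is i : 'I_n.-1,
   which involves the rows [row_lo i] (of value i) and [row_hi i] (i + 1). *)
Definition row_lo n (i : 'I_n.-1) : 'I_n := widen_ord (leq_pred n) i.

Lemma row_hi_subproof n (i : 'I_n.-1) : i.+1 < n.
Proof. by rewrite -ltn_predRL. Qed.

Definition row_hi n (i : 'I_n.-1) : 'I_n := Ordinal (row_hi_subproof i).

Section WeightLattice.
Local Open Scope ring_scope.
Variable n : nat.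

Definition diagonal : {pred 'rV[int]_n} :=
  fun v => [forall i, forall j, v 0 i == v 0 j].

Lemma diagonalP (v : 'rV[int]_n) :
  reflect (exists c : int, v = c *: \sum_j delta_mx 0 j) (v \in diagonal).
Proof.
have sumE k : (\sum_j delta_mx 0 j : 'rV[int]_n) 0 k = 1.
  rewrite summxE (bigD1 k) //= mxE !eqxx big1 ?addr0 // => j ne_jk.
  by rewrite mxE [k == j]eq_sym (negPf ne_jk) andbF.
apply: (iffP forallP) => [Hv | [c ->] i]; last first.
  by apply/forallP => j; rewrite !mxE !sumE.
case: (pickP 'I_n) => [i0 _ | no]; last first.
  by exists 0; apply/rowP => j; have := no j.
exists (v 0 i0); apply/rowP => j; rewrite mxE sumE mulr1.
by apply/eqP; have /forallP := Hv j; apply.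
Qed.

Lemma diagonal_zmod_closed : zmod_closed diagonal.
Proof.
split=> [|u v Hu Hv]; first by apply/forallP=> i; apply/forallP=> j; rewrite !mxE.
apply/forallP=> i; apply/forallP=> j; rewrite !mxE.
by rewrite (eqP (forallP (forallP Hu i) j)) (eqP (forallP (forallP Hv i) j)).
Qed.

HB.instance Definition _ :=
  GRing.isZmodClosed.Build 'rV[int]_n diagonal diagonal_zmod_closed.

Definition weight_lattice : zmodType := Quotient.quot diagonal.

Definition epsilon (j : 'I_n) : weight_lattice :=
  \pi_(weight_lattice) (delta_mx 0 j : 'rV[int]_n).

Definition alpha (i : 'I_n.-1) : weight_lattice :=
  epsilon (row_lo i) - epsilon (row_hi i).

(* <h_i, x>: independent of the representative of x, by [coroot_pi]. *)
Definition coroot (i : 'I_n.-1) (x : weight_lattice) : int :=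
  repr x 0 (row_lo i) - repr x 0 (row_hi i).

Lemma coroot_pi i (v : 'rV[int]_n) :
  coroot i (\pi_(weight_lattice) v) = v 0 (row_lo i) - v 0 (row_hi i).
Proof.
rewrite /coroot; set w := repr _.
have : w == v %[mod weight_lattice] by rewrite reprK.
rewrite -Quotient.idealrBE => /forallP/(_ (row_lo i))/forallP/(_ (row_hi i)).
rewrite !mxE => /eqP E.
by rewrite -[w 0 (row_lo i)](subrK (v 0 (row_lo i))) E addrAC addrC
  [w 0 _ - _]addrC addrK.
Qed.

Lemma coroot_epsilon i j :
  coroot i (epsilon j) = (row_lo i == j)%:R - (row_hi i == j)%:R.
Proof. by rewrite /epsilon coroot_pi !mxE. Qed.

End WeightLattice.

Section Crystal.
Variables (n : nat) (B : Type).

(* [None] is the element 0 adjoined to B. *)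
Definition iter_op (g : B -> option B) (k : nat) (b : B) : option B :=
  iter k (obind g) (Some b).

Definition is_max_power (g : B -> option B) (b : B) (k : nat) : Prop :=
  iter_op g k b <> None /\ (forall m, iter_op g m b <> None -> m <= k).

Local Open Scope ring_scope.

Record semiregular_crystal (wt : B -> weight_lattice n)
    (e f : 'I_n.-1 -> B -> option B) (eps phi : 'I_n.-1 -> B -> nat) : Prop :=
  SemiregularCrystal {
    crystal_eps : forall i b, is_max_power (e i) b (eps i b);
    crystal_phi : forall i b, is_max_power (f i) b (phi i b);
    crystal_C1 : forall i b,
      (phi i b)%:Z = (eps i b)%:Z + coroot i (wt b);
    crystal_C2 : forall i b b', e i b = Some b' -> wt b' = wt b + alpha i;
    crystal_C3 : forall i b b', f i b = Some b' -> wt b' = wt b - alpha i;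
    crystal_C4 : forall i b b', e i b = Some b' ->
      (eps i b')%:Z = (eps i b)%:Z - 1 /\ (phi i b')%:Z = (phi i b)%:Z + 1;
    crystal_C5 : forall i b b', f i b = Some b' ->
      (eps i b')%:Z = (eps i b)%:Z + 1 /\ (phi i b')%:Z = (phi i b)%:Z - 1;
    crystal_C6 : forall i b b', f i b = Some b' <-> e i b' = Some b }.

End Crystal.

Section Words.
Variables (T : eqType) (L R : pred T).
Implicit Types (w u v : seq T) (x y z : T).

(* Deletes the first subword LR, if any. *)
Fixpoint delete_LR w :=
  if w is x :: w1 then
    if w1 is y :: w2 then
      if L x && R y then w2 else x :: delete_LR w1
    else w
  else w.

(* No subword LR is left after [size w] deletions, by [reduce_irreducible]. *)
Definition reduce w := iter (size w) delete_LR w.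

Definition adjacent x y w := exists u v, w = u ++ x :: y :: v.

Lemma delete_LR_cons x y w :
  delete_LR [:: x, y & w] = if L x && R y then w else x :: delete_LR (y :: w).
Proof. by []. Qed.

Lemma delete_LR_subseq w : subseq (delete_LR w) w.
Proof.
elim: w => // x [|y w] IH; first exact: subseq_refl.
rewrite delete_LR_cons; case: ifP => _; last by rewrite /= eqxx.
exact: (subseq_trans (subseq_cons _ _) (subseq_cons _ _)).
Qed.

Lemma reduce_subseq w : subseq (reduce w) w.
Proof.
rewrite /reduce; elim: (size w) => [|k IH]; first exact: subseq_refl.
by rewrite iterS; apply: subseq_trans (delete_LR_subseq _) IH.
Qed.

Lemma delete_LR_adjacent x y w : L x -> R y -> adjacent x y w ->
  size (delete_LR w) < size w.
Proof.
move=> Lx Ry [u [v ->]]; elim: u => [|a u IH]; first by rewrite /= Lx Ry ltnW.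
case: u IH => [|b u] IH; rewrite !cat_cons delete_LR_cons;
  by case: ifP => _ //; rewrite /= ltnW.
Qed.

Lemma delete_LR_fixed w : delete_LR w = w \/ size (delete_LR w) < size w.
Proof.
elim: w => [|x [|y w] IH]; [by left | by left | rewrite delete_LR_cons].
case: ifP => _; first by right; rewrite /= ltnW.
by case: IH => [->|IH]; [left | right; rewrite /= ltnS].
Qed.

Lemma reduce_fixed w : delete_LR (reduce w) = reduce w.
Proof.
suff iterP k : delete_LR (iter k delete_LR w) = iter k delete_LR w \/
    size (iter k delete_LR w) + k <= size w.
  have [//|] := iterP (size w); rewrite -[X in _ <= X]add0n leq_add2r leqn0.
  by move/nilP; rewrite -/(reduce w) => ->.
elim: k => [|k [IH|IH]]; first by right; rewrite addn0.
  by left; rewrite iterS !IH.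
rewrite iterS; have [E|lt_w] := delete_LR_fixed (iter k delete_LR w).
  by left; rewrite !E.
by right; rewrite addnS -addSn; apply: leq_trans IH; rewrite leq_add2r.
Qed.

Lemma reduce_irreducible w x y : L x -> R y -> ~ adjacent x y (reduce w).
Proof.
by move=> Lx Ry /(delete_LR_adjacent Lx Ry); rewrite reduce_fixed ltnn.
Qed.

Lemma adjacent_delete_LR x y z w : z \in [:: x; y] ->
  (R x -> z = x) -> (L y -> z = y) -> uniq w -> adjacent x y w ->
  z \in delete_LR w -> adjacent x y (delete_LR w).
Proof.
move=> zxy Rx Ly Uw [u [v E]]; move: w E Uw => _ ->; elim: u => [|a u IH].
  case: v => [|t v] Uw.
    by rewrite /=; case: ifP => // _ _; exists [::], [::].
  rewrite cat0s !delete_LR_cons; move: Uw; rewrite /= !inE !negb_or.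
  case/and4P => /and3P[xy xt xv] /andP[yt yv] tv _.
  case: ifP => _.
    rewrite inE => /orP[/eqP zt|zv]; move: zxy; rewrite !inE.
      by rewrite zt ![t == _]eq_sym (negPf xt) (negPf yt).
    by case/orP=> /eqP zE; rewrite -zE zv in xv yv.
  case: ifP => [/andP[/Ly zy _]|_ _]; last first.
    by exists [::], (delete_LR (t :: v)).
  by rewrite inE zy eq_sym (negPf xy) (negPf yv).
move=> Uw; have Uw' : uniq (u ++ x :: y :: v) by case/andP: Uw.
have za : z != a.
  apply: contraTneq zxy => ->; move: Uw; rewrite cat_cons cons_uniq.
  case/andP; rewrite mem_cat !inE; case: (a == x); rewrite ?orbT //.
  by case: (a == y); rewrite ?orbT.
have rec : z \in a :: delete_LR (u ++ x :: y :: v) ->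
    adjacent x y (a :: delete_LR (u ++ x :: y :: v)).
  rewrite inE (negPf za) => /(IH Uw') [u' [v' ->]].
  by exists (a :: u'), v'.
case: u IH Uw Uw' rec => [|b u] IH Uw Uw' rec.
  rewrite cat_cons cat0s delete_LR_cons; case: ifP => [/andP[_ /Rx zx]|_ //].
  by move: Uw'; rewrite cat0s cons_uniq zx => /andP[/negPf ->].
rewrite !cat_cons delete_LR_cons; case: ifP => [_ _|_]; last exact: rec.
by exists u, v.
Qed.

Lemma adjacent_reduce x y z w : z \in [:: x; y] ->
  (R x -> z = x) -> (L y -> z = y) -> uniq w -> adjacent x y w ->
  z \in reduce w -> adjacent x y (reduce w).
Proof.
move=> zxy Rx Ly Uw Aw; rewrite /reduce; elim: (size w) => [//|k IH].
rewrite iterS => zk; apply: (adjacent_delete_LR zxy) => //.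
  elim: k {IH zk} => [//|k IH]; rewrite iterS.
  exact: subseq_uniq (delete_LR_subseq _) IH.
exact/IH/(mem_subseq (delete_LR_subseq _)).
Qed.

End Words.

Notation Plus := true (only parsing).
Notation Minus := false (only parsing).

(* The first component gives the signs of the vertical edges: [M.1 (k, q)] is
   the bottom edge of row k and the top edge of row k - 1 in column q.  The
   second one gives the signs of the horizontal edges: [M.2 (p, k)] is, in row
   p, the left edge of column k and the right edge of column k - 1. *)
Definition ice n s : Type :=
  ({ffun 'I_n.+1 * 'I_s -> bool} * {ffun 'I_n * 'I_s.+1 -> bool})%type.

Section Ice.
Variables n s : nat.
Implicit Types (M : ice n s) (p : 'I_n) (q : 'I_s) (i : 'I_n.-1).

Definition up_sign M p q := M.1 (lift ord0 p, q).
Definition left_sign M p q := M.2 (p, widen_ord (leqnSn s) q).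
Definition right_sign M p q := M.2 (p, lift ord0 q).
Definition down_sign M p q := M.1 (widen_ord (leqnSn n) p, q).

Definition vertex M p q := (up_sign M p q, left_sign M p q, right_sign M p q, down_sign M p q).

Definition type1 := (Plus, Plus, Plus, Plus).
Definition type2 := (Plus, Minus, Minus, Plus).
Definition type3 := (Plus, Minus, Plus, Minus).
Definition type4 := (Minus, Plus, Minus, Plus).
Definition type5 := (Minus, Minus, Minus, Minus).

Definition valid_types := [:: type1; type2; type3; type4; type5].

Definition five_vertex M : bool :=
  [forall p, forall q, vertex M p q \in valid_types].

Definition boxes M : {set 'I_n * 'I_s} :=
  [set b | vertex M b.1 b.2 == type2].

(* The i-signature, as the word of its boxes: a box in [row_lo i] stands for
   the letter L, a box in [row_hi i] for the letter R. *)
Definition signature i M : seq ('I_n * 'I_s) :=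
  [seq b <- [seq (p, q) | q <- enum 'I_s, p <- [:: row_lo i; row_hi i]]
     | b \in boxes M].

Definition is_L i (b : 'I_n * 'I_s) := b.1 == row_lo i.
Definition is_R i (b : 'I_n * 'I_s) := b.1 == row_hi i.

Definition reduced_signature i M : seq ('I_n * 'I_s) :=
  reduce (is_L i) (is_R i) (signature i M).

(* Replaces the signs of the four interior edges of the block in rows
   [row_lo i], [row_hi i] and columns c, c + 1:
   hu, hd are the horizontal ones in rows [row_hi i], [row_lo i];
   vl, vr are the vertical ones in columns c, c + 1. *)
Definition set_block i (c : nat) (hu hd vl vr : bool) M : ice n s :=
  ([ffun x : 'I_n.+1 * 'I_s =>
      if x.1 == i.+1 :> nat then
        if x.2 == c :> nat then vl
        else if x.2 == c.+1 :> nat then vr else M.1 x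
      else M.1 x],
   [ffun x : 'I_n * 'I_s.+1 =>
      if x.2 == c.+1 :> nat then
        if x.1 == row_hi i then hu
        else if x.1 == row_lo i then hd else M.2 x
      else M.2 x]).

Definition f_ice i M : option (ice n s) :=
  omap (fun b : 'I_n * 'I_s => set_block i b.2.-1 Minus Plus Plus Minus M)
    (ohead [seq b <- reduced_signature i M | is_L i b]).

Definition e_ice i M : option (ice n s) :=
  omap (fun b : 'I_n * 'I_s => set_block i b.2 Plus Minus Minus Plus M)
    (ohead (rev [seq b <- reduced_signature i M | is_R i b])).

Definition wt_ice M : weight_lattice n :=
  (\sum_(p < n) epsilon p *+ #|[set b in boxes M | b.1 == p]|)%R.

End Ice.

Definition is_partition n (lam : n.-tuple nat) : bool :=
  sorted geq lam && (last 0 lam == 0).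

Definition ncols n (lam : n.-tuple nat) : nat := head 0 lam + n.

(* For a partition, the subtraction below is not truncated. *)
Definition ice_state n (lam : n.-tuple nat) : pred (ice n (ncols lam)) :=
  fun M =>
  [&& five_vertex M,
      [forall q, (M.1 (ord_max, q) == Minus) ==
                 [exists j : 'I_n, val q == head 0 lam + j - tnth lam j]],
      [forall p, M.2 (p, ord0) == Plus],
      [forall q, M.1 (ord0, q) == Plus]
    & [forall p, M.2 (p, ord_max) == Minus]].

Definition ice_states n (lam : n.-tuple nat) : Type :=
  {M : ice n (ncols lam) | ice_state M}.

Section SetBlock.
Variables (n s : nat) (i : 'I_n.-1) (ql qr : 'I_s) (hu hd vl vr : bool).
Hypothesis qrE : qr = ql.+1 :> nat.
Variable M : ice n s.
Let N := set_block i ql hu hd vl vr M.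
Let lo := row_lo i.
Let hi := row_hi i.

Lemma five_vertex_set_block :
  (up_sign M hi ql, left_sign M hi ql, hu, vl) \in valid_types ->
  (up_sign M hi qr, hu, right_sign M hi qr, vr) \in valid_types ->
  (vl, left_sign M lo ql, hd, down_sign M lo ql) \in valid_types ->
  (vr, hd, right_sign M lo qr, down_sign M lo qr) \in valid_types ->
  five_vertex M -> five_vertex N.
Proof.
move=> Vhl Vhr Vll Vlr FM; apply/forallP => p; apply/forallP => q.
have VM := forallP (forallP FM p) q.
move: VM; rewrite /vertex /up_sign /left_sign /right_sign /down_sign !ffunE /=.
rewrite /bump !leq0n !add1n !eqSS.
have hE k : (k == hi) = (k == i.+1 :> nat) by [].
have lE k : (k == lo) = (k == i :> nat) by [].
rewrite !hE !lE.
have [phi|phi] := eqVneq (p : nat) i.+1.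
  have pE : p = hi by apply: val_inj.
  have -> : (p == i :> nat) = false by rewrite phi gtn_eqF.
  have [qE|qnl] := eqVneq (q : nat) ql.
    have -> : q = ql by apply: val_inj.
    by rewrite ltn_eqF // pE => _.
  have [qE|qnr] := eqVneq (q : nat) ql.+1; last by [].
  have -> : q = qr by apply: val_inj; rewrite /= qE.
  by rewrite pE.
have [plo|plo] := eqVneq (p : nat) i; last by rewrite !if_same.
have pE : p = lo by apply: val_inj.
have [qE|qnl] := eqVneq (q : nat) ql.
  have -> : q = ql by apply: val_inj.
  by rewrite ltn_eqF // pE => _.
have [qE|qnr] := eqVneq (q : nat) ql.+1; last by [].
have -> : q = qr by apply: val_inj; rewrite /= qE.
by rewrite pE.
Qed.

End SetBlock.

Section Closed.
Variables (n : nat) (lam : n.-tuple nat).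
Let s := ncols lam.
Implicit Types (M : ice n s) (i : 'I_n.-1).

Lemma ice_state_set_block i (ql qr : 'I_s) hu hd vl vr M :
  qr = ql.+1 :> nat -> five_vertex (set_block i ql hu hd vl vr M) ->
  ice_state M -> ice_state (set_block i ql hu hd vl vr M).
Proof.
move=> qrE FN /and5P[_ Mtop Mleft Mbot Mright].
have lt_i : i.+1 < n := row_hi_subproof i.
have lt_q : ql.+1 < s by rewrite -qrE.
apply/and5P; split=> //; apply/forallP => x; rewrite ffunE /=.
- by rewrite gtn_eqF //; exact: (forallP Mtop x).
- exact: (forallP Mleft x).
- exact: (forallP Mbot x).
- by rewrite gtn_eqF //; exact: (forallP Mright x).
Qed.

Lemma enum_ord_split (q : 'I_s) :
  enum 'I_s = take q (enum 'I_s) ++ q :: drop q.+1 (enum 'I_s).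
Proof.
rewrite -{1}(cat_take_drop q (enum 'I_s)) (drop_nth q) ?size_enum_ord //.
by rewrite nth_ord_enum.
Qed.

Definition column_word i M (q : 'I_s) :=
  [seq b <- [:: (row_lo i, q); (row_hi i, q)] | b \in boxes M].

Lemma signatureE i M :
  signature i M = flatten [seq column_word i M q | q <- enum 'I_s].
Proof.
rewrite /signature; elim: (enum 'I_s) => //= q e IH.
by rewrite /column_word /= -IH; do 2!case: ifP.
Qed.

Lemma signature_adjacent1 i M (q : 'I_s) x y :
  column_word i M q = [:: x; y] -> adjacent x y (signature i M).
Proof.
move=> E; rewrite signatureE (enum_ord_split q) map_cat flatten_cat /= E.
by eexists; eexists.
Qed.

Lemma signature_adjacent2 i M (ql qr : 'I_s) x y : qr = ql.+1 :> nat ->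
  column_word i M ql = [:: x] -> column_word i M qr = [:: y] ->
  adjacent x y (signature i M).
Proof.
move=> qrE El Er; rewrite signatureE (enum_ord_split ql) -qrE.
rewrite (drop_nth qr) ?size_enum_ord // nth_ord_enum.
by rewrite map_cat flatten_cat /= El Er; eexists; eexists.
Qed.

Lemma mem_signature i M b : b \in signature i M ->
  (b \in boxes M) && ((b.1 == row_lo i) || (b.1 == row_hi i)).
Proof.
rewrite mem_filter => /andP[-> /allpairsP[[q p] /= [_ + ->]]] /=.
by rewrite !inE.
Qed.

Lemma signature_uniq i M : uniq (signature i M).
Proof.
apply/filter_uniq/allpairs_uniq; rewrite ?enum_uniq //=.
  by rewrite andbT inE -val_eqE /= ltn_eqF.
by move=> [q p] [q' p'] _ _ /= [-> ->].
Qed.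

End Closed.

Section Operators.
Variables (n : nat) (lam : n.-tuple nat) (i : 'I_n.-1).
Let s := ncols lam.
Let lo := row_lo i.
Let hi := row_hi i.
Implicit Types (M : ice n s) (q : 'I_s).

Let hi_lo : (hi == lo) = false.
Proof. by apply: gtn_eqF. Qed.

Let hi_down M q : down_sign M hi q = up_sign M lo q.
Proof. by congr (M.1 (_, q)); apply: val_inj. Qed.

Let right_left M p (ql qr : 'I_s) : qr = ql.+1 :> nat ->
  right_sign M p ql = left_sign M p qr.
Proof. by move=> qrE; congr (M.2 (p, _)); apply: val_inj. Qed.

Let vertex_valid M p q : ice_state M -> vertex M p q \in valid_types.
Proof. by case/and5P => /forallP/(_ p)/forallP/(_ q). Qed.

Let box_vertex M p q : ((p, q) \in boxes M) = (vertex M p q == type2).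
Proof. by rewrite inE. Qed.

Let f_block (a b h u e g k m : bool) :
  (a, b, h, u) \in valid_types -> (u, e, Minus, g) \in valid_types ->
  (k, h, m, Plus) \in valid_types -> (k, h, m, Plus) != type2 ->
  ~ ((u, e, Minus, g) == type2 /\ (a, b, h, u) != type2) ->
  [/\ (a, b, Minus, Plus) \in valid_types,
      (k, Minus, m, Minus) \in valid_types
    & (Plus, e, Plus, g) \in valid_types].
Proof.
by case: h; case: u; case: k => //; case: m => //; case: a => //;
  case: b => //; case: e => //; case: g => // _ _ _ _ []; split.
Qed.

Let e_block (b d a f c g k : bool) :
  (Plus, b, Plus, d) \in valid_types -> (a, Plus, f, c) \in valid_types ->
  (g, Minus, k, a) \in valid_types ->
  ~ ((g, Minus, k, a) == type2 /\ (a, Plus, f, c) != type2) ->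
  [/\ (g, Plus, k, Plus) \in valid_types,
      (Minus, b, Minus, d) \in valid_types
    & (Plus, Minus, f, c) \in valid_types].
Proof.
by case: a; case: g; case: k => //; case: f => //; case: c => //;
  case: b => //; case: d => // _ _ _ []; split.
Qed.

Lemma f_ice_closed M N : ice_state M -> f_ice i M = Some N -> ice_state N.
Proof.
move=> MM; rewrite /f_ice.
case E: [seq b <- _ | _] => [|[p q] w] //= [<-].
have : (p, q) \in [seq b <- reduced_signature i M | is_L i b].
  by rewrite E mem_head.
rewrite mem_filter /is_L /= => /andP[/eqP pE qred].
move: E qred; rewrite {p}pE -/lo => E qred.
have Usig := signature_uniq i M.
have /mem_signature/andP[box_q _] : (lo, q) \in signature i M.
  exact: mem_subseq (reduce_subseq _ _ _) _ qred.
have no_hi : (hi, q) \notin boxes M.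
  apply/negP => box_hi.
  apply: (@reduce_irreducible _ (is_L i) (is_R i) (signature i M) (lo, q) (hi, q)).
  - exact: eqxx.
  - exact: eqxx.
  apply: (adjacent_reduce _ _ _ Usig _ qred); first exact: mem_head.
  - by rewrite /is_R /= eq_sym hi_lo.
  - by rewrite /is_L /= hi_lo.
  by apply: (@signature_adjacent1 _ _ _ _ q); rewrite /column_word /= box_q box_hi.
have left_q : left_sign M lo q = Minus.
  by move: box_q; rewrite box_vertex => /eqP[].
have q_gt0 : 0 < q.
  rewrite lt0n; apply/negP => /eqP q0; case/and5P: MM => _ _ /forallP/(_ lo) + _ _.
  suff -> : M.2 (lo, ord0) = left_sign M lo q by rewrite left_q.
  by congr (M.2 (lo, _)); apply: val_inj.
have lt_ql : q.-1 < s by rewrite prednK // ltnW.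
pose ql : 'I_s := Ordinal lt_ql; have qE : q = ql.+1 :> nat by rewrite /= prednK.
have no_L : ~ ((lo, ql) \in boxes M /\ (hi, ql) \notin boxes M).
  case=> box_l /negPf no_hil.
  have : adjacent (lo, ql) (lo, q) (reduced_signature i M).
    apply: (adjacent_reduce _ _ _ Usig _ qred) => //.
    - by rewrite !inE eqxx orbT.
    - by rewrite /is_R /= eq_sym hi_lo.
    apply: (signature_adjacent2 qE); rewrite /column_word /=.
      by rewrite box_l no_hil.
    by rewrite box_q (negPf no_hi).
  have Ured : uniq (reduced_signature i M).
    exact: subseq_uniq (reduce_subseq _ _ _) Usig.
  case=> u [v Eu]; move: E Ured; rewrite Eu => E Ured; move: E.
  rewrite filter_cat /= /is_L /= !eqxx => E.
  have : (lo, q) \in u ++ [:: (lo, ql)].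
    have: (lo, q) \in [seq b <- u | b.1 == lo] ++ [:: (lo, ql)].
      by case: [seq b <- u | _] E => [|a u'] [-> _]; rewrite mem_head.
    by rewrite !mem_cat => /orP[|->]; rewrite ?orbT // mem_filter => /andP[_ ->].
  move: Ured; rewrite cat_uniq => /and3P[_ /hasPn notin_u /andP[notin_v _]].
  rewrite mem_cat inE => /orP[q_u|/eqP q_ql].
    by have := notin_u (lo, q); rewrite !inE eqxx orbT /= q_u => /(_ isT).
  by move: notin_v; rewrite q_ql mem_head.
have VM p q' := vertex_valid p q' MM.
apply: (@ice_state_set_block _ _ _ ql q) => //.
move: no_hi no_L (VM lo ql) (VM hi ql) (VM hi q); rewrite !box_vertex /vertex.
rewrite !hi_down !(right_left _ _ qE).
move: box_q; rewrite box_vertex => /eqP[uq lq rq dq]; rewrite uq lq.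
move=> no_hi no_L Vll Vhl Vhr; have [V1 V2 V3] := f_block Vhl Vll Vhr no_hi no_L.
apply: (five_vertex_set_block qE) => //; last by case/and5P: MM.
by rewrite rq dq.
Qed.

Lemma e_ice_closed M N : ice_state M -> e_ice i M = Some N -> ice_state N.
Proof.
move=> MM; rewrite /e_ice.
case E: (rev _) => [|[p q] w] //= [<-].
have : (p, q) \in [seq b <- reduced_signature i M | is_R i b].
  by rewrite -mem_rev E mem_head.
rewrite mem_filter /is_R /= => /andP[/eqP pE qred].
move: E qred; rewrite {p}pE -/hi => E qred.
have Usig := signature_uniq i M.
have /mem_signature/andP[box_q _] : (hi, q) \in signature i M.
  exact: mem_subseq (reduce_subseq _ _ _) _ qred.
have no_lo : (lo, q) \notin boxes M.
  apply/negP => box_lo.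
  apply: (@reduce_irreducible _ (is_L i) (is_R i) (signature i M) (lo, q) (hi, q)).
  - exact: eqxx.
  - exact: eqxx.
  apply: (adjacent_reduce _ _ _ Usig _ qred).
  - by rewrite !inE eqxx orbT.
  - by rewrite /is_R /= eq_sym hi_lo.
  - by rewrite /is_L /= hi_lo.
  by apply: (@signature_adjacent1 _ _ _ _ q); rewrite /column_word /= box_lo box_q.
have right_q : right_sign M lo q = Plus.
  have := vertex_valid lo q MM; move: box_q no_lo.
  rewrite !box_vertex /vertex hi_down => /eqP[_ _ _ ->].
  by case: (left_sign M lo q); case: (right_sign M lo q); case: (down_sign M lo q).
have lt_qr : q.+1 < s.
  rewrite ltn_neqAle ltn_ord andbT; apply/negP => /eqP qs.
  case/and5P: MM => _ _ _ _ /forallP/(_ lo).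
  suff -> : M.2 (lo, ord_max) = right_sign M lo q by rewrite right_q.
  by congr (M.2 (lo, _)); apply: val_inj.
pose qr : 'I_s := Ordinal lt_qr; have qE : qr = q.+1 :> nat by [].
have no_R : ~ ((hi, qr) \in boxes M /\ (lo, qr) \notin boxes M).
  case=> box_r /negPf no_lor.
  have : adjacent (hi, q) (hi, qr) (reduced_signature i M).
    apply: (adjacent_reduce _ _ _ Usig _ qred) => //.
    - exact: mem_head.
    - by rewrite /is_L /= hi_lo.
    apply: (signature_adjacent2 qE); rewrite /column_word /=.
      by rewrite (negPf no_lo) box_q.
    by rewrite box_r no_lor.
  have Ured : uniq (reduced_signature i M).
    exact: subseq_uniq (reduce_subseq _ _ _) Usig.
  case=> u [v Eu]; move: E Ured; rewrite Eu => E Ured; move: E.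
  rewrite filter_cat /= /is_R /= !eqxx rev_cat !rev_cons !cat_rcons => E.
  have : (hi, q) \in (hi, qr) :: v.
    have: (hi, q) \in rev [seq b <- v | b.1 == hi] ++ [:: (hi, qr)].
      by case: (rev _) E => [|a v'] [-> _]; rewrite mem_head.
    rewrite mem_cat mem_rev mem_filter mem_seq1 in_cons orbC.
    by case/orP => [->|/andP[_ ->]]; rewrite ?orbT.
  move: Ured; rewrite cat_uniq cons_uniq => /and3P[_ _ /andP[q_in _]].
  by rewrite (negPf q_in).
have VM p q' := vertex_valid p q' MM.
apply: (@ice_state_set_block _ _ _ q qr) => //.
move: no_lo no_R right_q (VM lo q) (VM lo qr) (VM hi qr).
rewrite !box_vertex /vertex !hi_down !(right_left _ _ qE) => no_lo no_R right_q.
move: box_q; rewrite box_vertex /vertex hi_down (right_left _ _ qE).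
case/eqP=> uq lq rq dq; rewrite right_q rq dq.
rewrite right_q rq in no_R.
move=> Vll Vlr Vhr; have [V1 V2 V3] := e_block Vll Vlr Vhr no_R.
apply: (five_vertex_set_block qE) => //; last by case/and5P: MM.
by rewrite uq lq.
Qed.

End Operators.

Section CrystalOperators.
Variables (n : nat) (lam : n.-tuple nat) (i : 'I_n.-1).
Implicit Type M : ice_states lam.

(* [insub] never fails here, by [val_e_op] and [val_f_op]: [None] only arises
   from the absence of the relevant letter in the reduced signature. *)
Definition e_op M : option (ice_states lam) := obind insub (e_ice i (val M)).

Definition f_op M : option (ice_states lam) := obind insub (f_ice i (val M)).

Lemma val_e_op M : omap val (e_op M) = e_ice i (val M).
Proof.
rewrite /e_op; case E: (e_ice i _) => [N|] //=.
by rewrite insubT //; apply: e_ice_closed E; apply: valP.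
Qed.

Lemma val_f_op M : omap val (f_op M) = f_ice i (val M).
Proof.
rewrite /f_op; case E: (f_ice i _) => [N|] //=.
by rewrite insubT //; apply: f_ice_closed E; apply: valP.
Qed.

End CrystalOperators.

Definition wt n (lam : n.-tuple nat) (M : ice_states lam) : weight_lattice n :=
  wt_ice (val M).

(* Main.v *)
(* The operator f_i changes a 2 x 2 block of signs, and validity of the vertices
before and after the change forces the four old signs.  On boxes its only effect
is to slide the box (i, q + 1) to (i + 1, q).  No cell of rows i, i + 1 lies
between these two in the order of the signature, so the i-signature changes from
u L v to u R v.  The letter L is the first one of the reduced word iff u reduces
to R's only and v to L's only, and this is also the condition for R to be the
last R of the reduction of u R v: hence e_i and f_i are mutually inverse, and
eps_i and phi_i count the R's and the L's of the reduced signature. *)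
Require Import Defs.
From mathcomp Require Import all_boot all_order all_algebra zify.
Set Implicit Arguments.
Unset Strict Implicit.
Unset Printing Implicit Defensive.
Import GRing.Theory.

(** * Bracket cancellation in words of L's and R's *)

Section Reduction.
Variables (T : eqType) (L R : pred T).
Hypothesis LR_disjoint : forall x, L x -> R x = false.
Implicit Types (x y : T) (u v w s t : seq T).

(* [stack] below computes the reduced word from right to left. *)
Definition push x s :=
  if s is y :: s' then if L x && R y then s' else x :: s else [:: x].

Definition stack w := foldr push [::] w.

Lemma push_R x s : R x -> push x s = x :: s.
Proof.
move=> Rx; case: s => //= y s; case Lx: (L x) => //.
by rewrite LR_disjoint in Rx.
Qed.

(** An R is always pushed, and an L just to its left pops it again, so a subword LR leaves the stack
    as it was. *)
Lemma stack_delete_LR w : stack (delete_LR L R w) = stack w.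
Proof.
elim: w => // x [|y w] IH //; rewrite delete_LR_cons.
case: ifP => [/andP[Lx Ry]|_]; last by rewrite /= IH.
by rewrite /= [push y _]push_R //= Lx Ry.
Qed.

Lemma stack_fixed w : delete_LR L R w = w -> stack w = w.
Proof.
elim: w => // x [|y w] IH //; rewrite delete_LR_cons.
case: ifP => [_ /(congr1 size) /= E|LRxy [/IH /= ->]]; last by rewrite /= LRxy.
by have := ltnW (ltnSn (size w).+1); rewrite -E ltnn.
Qed.

(** Deletions preserve the stack, and an irreducible word is its own stack. *)
Lemma reduceE w : reduce L R w = stack w.
Proof.
rewrite -(stack_fixed (reduce_fixed L R w)) /reduce.
by elim: (size w) => //= k IH; rewrite stack_delete_LR.
Qed.

Lemma stack_all w :
  all (fun z => L z || R z) w -> all (fun z => L z || R z) (stack w).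
Proof.
elim: w => //= x w IH /andP[LRx /IH]; rewrite /push.
case: (stack w) => [|y s] /=; first by rewrite LRx.
by case: ifP => _ /= => [/andP[] //|->]; rewrite LRx.
Qed.

(** An R joins the leading R's; an L pops the first of them or, when there is none, joins the
    L's. *)
Lemma stack_normal w : all (fun z => L z || R z) w ->
  stack w = filter R (stack w) ++ filter L (stack w).
Proof.
elim: w => //= x w IH /andP[LRx LRw]; have := stack_all LRw.
have {IH} := IH LRw; case: (boolP (R x)) => [Rx|nRx].
  rewrite push_R //= Rx; case: ifP => [/LR_disjoint|_ E _]; first by rewrite Rx.
  by rewrite cat_cons -E.
move: LRx; rewrite /= (negPf nRx) orbF => Lx.
case: (stack w) => [|y s] /=; first by rewrite Lx (negPf nRx).
rewrite Lx; case: (boolP (R y)) => [Ry|nRy] /=.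
  by case: ifP => [/LR_disjoint|_ [<-] //]; rewrite Ry.
rewrite orbF (negPf nRx) (negPf nRy) => + /andP[Ly _]; rewrite Ly.
case E: (filter R s) => [|z t] /=; first by rewrite Lx => ->.
by case=> yz _; have := mem_head z t; rewrite -E mem_filter -yz (negPf nRy).
Qed.

(** When [u] reduces to R's only, all its L's are matched inside [u], so nothing of [s] is
    popped. *)
Lemma stack_cat u s : all R (stack u) -> foldr push s u = stack u ++ s.
Proof.
elim: u => //= x u IH; case: (boolP (R x)) => [Rx|nRx].
  by rewrite !push_R //= => /andP[_ /IH->].
case: (stack u) IH => [|y t] IH /=; first by rewrite (negPf nRx).
case: ifP => [/andP[Lx Ry]|_] /=; last by rewrite (negPf nRx).
by move=> Rt; rewrite IH /= ?Ry // Lx.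
Qed.

Lemma stack_pivot u x v : all R (stack u) -> all L (stack v) ->
  stack (u ++ x :: v) = stack u ++ x :: stack v.
Proof.
move=> Ru Lv; rewrite /stack foldr_cat stack_cat //= -/(stack v).
case: (stack v) Lv => //= y s /andP[Ly _].
by rewrite (LR_disjoint Ly) andbF.
Qed.

(** A converse to [stack_pivot]: a surviving letter preceded by R's only is traced back to its place
    in [w], and the two sides of that place reduce independently. *)
Lemma stack_split w s x t : all (fun z => L z || R z) w ->
    stack w = s ++ x :: t -> all R s ->
  exists u v, [/\ w = u ++ x :: v, stack u = s & stack v = t].
Proof.
elim: w s => [|a w IH] s /=; first by case: s.
case/andP=> LRa LRw; case: (boolP (R a)) => [Ra|nRa].
  rewrite push_R //; case: s => [[<- <-] _|b s [<- E] /= /andP[_ Rs]].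
    by exists [::], w.
  have [u [v [-> Eu Ev]]] := IH s LRw E Rs.
  by exists (a :: u), v; split; rewrite //= push_R // Eu.
have no_s c : a :: c = s ++ x :: t -> all R s ->
    [/\ s = [::], x = a & t = c].
  by case: s => [[-> ->]|b s [<- _]] //=; rewrite (negPf nRa).
have La : L a by move: LRa; rewrite /= (negPf nRa) orbF.
case Ew: (stack w) => [|y c] /=.
  by move=> /no_s/[apply] -[-> -> ->]; exists [::], w.
case: ifP => [/andP[_ Ry] E Rs|_]; last first.
  by move=> /no_s/[apply] -[-> -> ->]; exists [::], w.
(* The L [a] pops [y], so in the stack of the tail the prefix before [x] is [y :: s]. *)
have [||u [v [-> Eu Ev]]] := IH (y :: s) LRw; rewrite ?Ew ?E //= ?Ry //.
by exists (a :: u), v; split; rewrite //= Eu /= La Ry.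
Qed.

(** Each cancellation removes one L and one R; the invariance of the difference is written
    additively to avoid truncated subtraction. *)
Lemma count_stack w :
  count L (stack w) + count R w = count L w + count R (stack w).
Proof.
elim: w => //= x w; rewrite /push; case: (stack w) => [|y s] /=; first by lia.
case: ifP => [/andP[Lx Ry]|_] /=; last by lia.
case Ly: (L y); first by rewrite LR_disjoint in Ry.
by rewrite Lx Ry (LR_disjoint Lx); lia.
Qed.

(* When this holds, a letter x of u ++ x :: v is unmatched, whether it is an L or an R. *)
Definition pivot u v := all R (reduce L R u) && all L (reduce L R v).

Lemma reduce_pivot u x v : pivot u v ->
  reduce L R (u ++ x :: v) = reduce L R u ++ x :: reduce L R v.
Proof. by rewrite /pivot !reduceE => /andP[]; apply: stack_pivot. Qed.

(** Stated for any letter [x], to serve both before and after an L turns into an R. *)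
Lemma filter_reduce_pivot u x v : pivot u v ->
  filter L (reduce L R (u ++ x :: v)) = filter L [:: x] ++ reduce L R v /\
  filter R (reduce L R (u ++ x :: v)) = reduce L R u ++ filter R [:: x].
Proof.
move=> uv; rewrite reduce_pivot // !filter_cat -cat1s !filter_cat.
case/andP: uv => Ru Lv; rewrite (all_filterP Ru) (all_filterP Lv).
have -> : filter L (reduce L R u) = [::].
  by apply/eqP; rewrite -(negbK (_ == _)) -has_filter; apply/hasPn => y
    /(allP Ru) Ry; apply/negP => /LR_disjoint; rewrite Ry.
have -> : filter R (reduce L R v) = [::].
  by apply/eqP; rewrite -(negbK (_ == _)) -has_filter; apply/hasPn => y
    /(allP Lv)/LR_disjoint ->.
by rewrite cats0.
Qed.

(** In the normal form only R's precede the first L and only L's follow it, so [stack_split] applies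
    there. *)
Lemma first_L_pivot w x t : all (fun z => L z || R z) w ->
    filter L (reduce L R w) = x :: t ->
  exists u v, w = u ++ x :: v /\ pivot u v.
Proof.
rewrite reduceE => LRw E; have := stack_normal LRw; rewrite E => Ew.
have [|u [v [-> Eu Ev]]] := stack_split LRw Ew; first exact: filter_all.
exists u, v; split=> //; rewrite /pivot !reduceE Eu Ev filter_all /=.
by have := filter_all L (stack w); rewrite E => /andP[].
Qed.

Lemma last_R_pivot w x t : all (fun z => L z || R z) w ->
    rev (filter R (reduce L R w)) = x :: t ->
  exists u v, w = u ++ x :: v /\ pivot u v.
Proof.
rewrite reduceE => LRw E; have := stack_normal LRw.
have /eqP := congr1 rev E; rewrite revK rev_cons => /eqP {}E.
have := filter_all R (stack w); rewrite E all_rcons => /andP[_ Rt].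
rewrite cat_rcons => Ew.
have [u [v [-> Eu Ev]]] := stack_split LRw Ew Rt.
by exists u, v; split=> //; rewrite /pivot !reduceE Eu Ev Rt filter_all.
Qed.

Lemma count_reduce w :
  count L (reduce L R w) + count R w = count L w + count R (reduce L R w).
Proof. by rewrite reduceE count_stack. Qed.

End Reduction.

(** A count that drops by one along [g] and is zero where [g] is undefined measures how often [g]
    applies; the induction is on its value. *)
Lemma max_power_count (B : Type) (g : B -> option B) (c : B -> nat) :
    (forall b, g b = None -> c b = 0) ->
    (forall b b', g b = Some b' -> c b = (c b').+1) ->
  forall b, is_max_power g b (c b).
Proof.
move=> g0 gS b.
have iterN k : iter k (obind g) None = None by elim: k => //= k ->.
have [k cb] : exists k, c b = k by exists (c b).
rewrite cb; elim: k b cb => [|k IH] b cb.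
  rewrite /is_max_power /iter_op; split=> [|[|m]] //; rewrite iterSr /=.
  by case E: (g b) => [b'|]; [rewrite (gS _ _ E) in cb | rewrite iterN].
case E: (g b) => [b'|]; last by rewrite (g0 _ E) in cb.
have [|IH1 IH2] := IH b'; first by have := gS _ _ E; rewrite cb => -[].
rewrite /is_max_power /iter_op.
by split=> [|[|m]] //; rewrite iterSr /= E //; apply: IH2.
Qed.

(** * The effect of the sign change on vertices, boxes and signatures *)

Section Block.
Variables (n s : nat) (i : 'I_n.-1) (ql qr : 'I_s).
Hypothesis qrE : qr = ql.+1 :> nat.
Implicit Types M N : ice n s.
Let lo := row_lo i.
Let hi := row_hi i.

(** The signs come in the order of the arguments of [set_block]. *)
Definition block_signs M :=
  (right_sign M hi ql, right_sign M lo ql, up_sign M lo ql, up_sign M lo qr).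

Lemma hi_lo : (hi == lo) = false.
Proof. by apply: gtn_eqF. Qed.

Lemma down_sign_hi M q : down_sign M hi q = up_sign M lo q.
Proof. by congr (M.1 (_, q)); apply: val_inj. Qed.

Lemma left_sign_succ M p : left_sign M p qr = right_sign M p ql.
Proof. by congr (M.2 (p, _)); apply: val_inj. Qed.

Lemma block_signs_set_block a b c d M :
  block_signs (set_block i ql a b c d M) = (a, b, c, d).
Proof.
rewrite /block_signs /right_sign /up_sign !ffunE /= /bump !leq0n !add1n.
by rewrite !eqxx eq_sym hi_lo qrE gtn_eqF // eqxx.
Qed.

(** Writing the original signs back undoes any change of the block; this is how [e_ice] inverts
    [f_ice]. *)
Lemma set_blockK a b c d a' b' c' d' M : block_signs M = (a, b, c, d) ->
  set_block i ql a b c d (set_block i ql a' b' c' d' M) = M.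
Proof.
case: M => [V H].
rewrite /block_signs /right_sign /up_sign /= => -[<- <- <- <-].
congr pair; apply/ffunP => -[x y]; rewrite !ffunE /=.
  case: eqP => // xE; case: eqP => [yE|_]; last case: eqP => // yE.
    by congr (V (_, _)); apply: val_inj.
  by congr (V (_, _)); apply: val_inj; rewrite //= qrE.
case: eqP => // yE; case: eqP => [->|_]; last case: eqP => // ->.
  by congr (H (_, _)); apply: val_inj.
by congr (H (_, _)); apply: val_inj.
Qed.

Lemma vertex_set_block a b c d M p q :
  vertex (set_block i ql a b c d M) p q =
    if (p, q) == (hi, ql) then (up_sign M p q, left_sign M p q, a, c)
    else if (p, q) == (hi, qr) then (up_sign M p q, a, right_sign M p q, d)
    else if (p, q) == (lo, ql) then (c, left_sign M p q, b, down_sign M p q)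
    else if (p, q) == (lo, qr) then (d, b, right_sign M p q, down_sign M p q)
    else vertex M p q.
Proof.
rewrite /vertex /up_sign /left_sign /right_sign /down_sign !ffunE /=.
rewrite /bump !leq0n !add1n !eqSS !xpair_eqE.
have -> : (q == qr) = (q == ql.+1 :> nat) by rewrite -qrE.
have -> : (q == ql) = (q == ql :> nat) by [].
have -> : (p == lo) = (p == i :> nat) by [].
have -> : (p == hi) = (p == i.+1 :> nat) by [].
have [->|phi] := eqVneq (p : nat) i.+1; have [->|qnl] := eqVneq (q : nat) ql;
  rewrite ?[i.+1 == i]gtn_eqF ?[ql == ql.+1 :> nat]ltn_eqF //=;
  try by case: ifP.
by rewrite andbF; case: eqP; case: eqP.
Qed.

(** The sign change without the choice of a box; recording the old signs makes it reversible. *)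
Definition slide M N :=
  block_signs M = (Plus, Minus, Minus, Plus) /\
  N = set_block i ql Minus Plus Plus Minus M.

(** Validity forces the upper left vertex to go from type 3 to type 2 and the lower right one from
    type 2 to type 4; the other two are boxes neither before nor after. *)
Lemma boxes_slide M N : five_vertex M -> five_vertex N -> slide M N ->
  [/\ (lo, qr) \in boxes M, (hi, ql) \notin boxes M
    & boxes N = (hi, ql) |: (boxes M :\ (lo, qr))].
Proof.
move=> FM FN [SM NE].
have VM p q := forallP (forallP FM p) q.
have VN p q := forallP (forallP FN p) q.
have ql_qr : (ql == qr) = false by rewrite -val_eqE /= qrE ltn_eqF.
have := (VM lo ql, VM lo qr, VM hi ql, VM hi qr).
have := (VN lo ql, VN lo qr, VN hi ql, VN hi qr).
have bN b : (b \in boxes N) = (vertex N b.1 b.2 == type2) by rewrite inE.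
have bM b : (b \in boxes M) = (vertex M b.1 b.2 == type2) by rewrite inE.
rewrite NE !vertex_set_block -NE !xpair_eqE !eqxx ![lo == hi]eq_sym hi_lo.
rewrite ![qr == _]eq_sym ql_qr /= {VM VN}.
case: SM => Sa Sb Sc Sd.
rewrite /vertex !down_sign_hi !left_sign_succ Sa Sb Sc Sd.
move=> [[[n1 n2] n3] n4] [[[m1 m2] m3] m4].
(* In [M] this vertex has right sign + and bottom sign -, hence type 3. *)
have N1 : (up_sign M hi ql, left_sign M hi ql) = (Plus, Minus).
  by move: n3 m3; case: (up_sign M hi ql); case: (left_sign M hi ql).
(* In [N] this vertex has top sign - and left sign +, hence type 4. *)
have N2 : (right_sign M lo qr, down_sign M lo qr) = (Minus, Plus).
  by move: n2; case: (right_sign M lo qr); case: (down_sign M lo qr).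
case: N1 N2 => [uE lE] [rE dE].
split.
- by rewrite bM /vertex /= Sd left_sign_succ Sb rE dE.
- by rewrite bM /vertex /= uE lE Sa.
apply/setP => -[p q]; rewrite in_setU1 in_setD1 bN bM NE vertex_set_block /=.
case: ((p, q) =P (hi, ql)) => [[-> ->]|_]; first by rewrite uE lE.
case: ((p, q) =P (hi, qr)) => [[-> ->]|_].
  rewrite /vertex left_sign_succ Sa !xpair_eqE [hi == _]hi_lo /=.
  by case: (up_sign M hi qr); case: (right_sign M hi qr); rewrite ?andbF.
case: ((p, q) =P (lo, ql)) => [[-> ->]|_].
  rewrite /vertex Sc !xpair_eqE ql_qr andbF /=.
  by case: (left_sign M lo ql); rewrite ?andbF.
by case: ((p, q) =P (lo, qr)) => [[-> ->]|_].
Qed.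

(** The box gives two of the four old signs; a wrong value of the other two makes the lower left or
    the upper right vertex invalid in [M] or in [N]. *)
Lemma slide_lower M N : five_vertex M -> five_vertex N ->
  (lo, qr) \in boxes M -> N = set_block i ql Minus Plus Plus Minus M ->
  slide M N.
Proof.
move=> FM FN box NE; split=> //; move: box; rewrite inE => /eqP boxE.
have VM p q := forallP (forallP FM p) q.
have VN p q := forallP (forallP FN p) q.
have ql_qr : (ql == qr) = false by rewrite -val_eqE /= qrE ltn_eqF.
move: (VM lo ql) (VM hi ql) (VM hi qr) (VN lo ql) (VN hi ql) (VN hi qr).
rewrite NE !vertex_set_block !xpair_eqE !eqxx ![lo == hi]eq_sym hi_lo.
rewrite ![qr == _]eq_sym ql_qr /= /block_signs.
move: boxE; rewrite /vertex !left_sign_succ !down_sign_hi => -[-> -> _ _].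
move: (right_sign M hi ql) (up_sign M lo ql) => h u.
case: h; case: u => //.
- by case: (left_sign M lo ql); case: (down_sign M lo ql).
- by case: (up_sign M hi qr); case: (right_sign M hi qr).
- by case: (up_sign M hi qr); case: (right_sign M hi qr).
Qed.

(** As for [slide_lower], now with two signs of [N] given by its box and the same two vertices
    forcing the others. *)
Lemma slide_raise M N : five_vertex M -> five_vertex N ->
  (hi, ql) \in boxes N -> M = set_block i ql Plus Minus Minus Plus N ->
  slide M N.
Proof.
move=> FM FN box ME.
have SN : block_signs N = (Minus, Plus, Plus, Minus).
  move: box; rewrite inE => /eqP boxE.
  have VM p q := forallP (forallP FM p) q.
  have VN p q := forallP (forallP FN p) q.
  have ql_qr : (ql == qr) = false by rewrite -val_eqE /= qrE ltn_eqF.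
  move: (VN lo ql) (VN hi qr) (VM lo ql) (VM hi qr).
  rewrite ME !vertex_set_block !xpair_eqE !eqxx ![lo == hi]eq_sym hi_lo.
  rewrite ![qr == _]eq_sym ql_qr /= /block_signs.
  move: boxE; rewrite /vertex !left_sign_succ !down_sign_hi => -[_ _ -> ->].
  move: (right_sign N lo ql) (up_sign N lo qr) => h u.
  case: h; case: u => //; try by
    case: (up_sign N hi qr); case: (right_sign N hi qr).
  by case: (left_sign N lo ql); case: (down_sign N lo ql).
by split; [rewrite ME block_signs_set_block | rewrite ME set_blockK].
Qed.

Lemma signature_slide M N : five_vertex M -> five_vertex N -> slide M N ->
  exists u v, signature i M = u ++ (lo, qr) :: v /\
              signature i N = u ++ (hi, ql) :: v.
Proof.
move=> FM FN /(boxes_slide FM FN)[box nbox bE].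
pose cells := [seq (p, q) | q <- enum 'I_s, p <- [:: lo; hi]].
(* Column [ql] ends with its [hi] cell and column [qr] begins with its [lo] cell, so the two cells
   are consecutive. *)
have [u [v E]] : exists u v, cells = u ++ [:: (hi, ql), (lo, qr) & v].
  pose e := enum 'I_s; have : e = take ql e ++ [:: ql, qr & drop ql.+2 e].
    rewrite -{1}(cat_take_drop ql e) (drop_nth ql) ?size_enum_ord //.
    rewrite nth_ord_enum (drop_nth qr) -?qrE ?size_enum_ord //.
    by rewrite nth_ord_enum.
  rewrite /cells -/e => {1}->; rewrite map_cat flatten_cat /=.
  set x := flatten _; set y := flatten _.
  by exists (rcons x (lo, ql)), ((hi, qr) :: y); rewrite cat_rcons.
(* Without repetition, neither cell occurs in [u] or [v], where the boxes of [M] and [N] therefore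
   agree. *)
have Ucells : uniq cells.
  apply: allpairs_uniq; rewrite ?enum_uniq //=.
    by rewrite andbT inE eq_sym hi_lo.
  by move=> [q p] [q' p'] _ _ /= [-> ->].
exists [seq b <- u | b \in boxes M], [seq b <- v | b \in boxes M].
have boxN : (hi, ql) \in boxes N by rewrite bE setU11.
have nboxN : (lo, qr) \in boxes N = false.
  by rewrite bE in_setU1 in_setD1 eqxx xpair_eqE [lo == hi]eq_sym hi_lo.
rewrite /signature -/lo -/hi -/cells E !filter_cat /=.
rewrite box (negPf nbox) boxN nboxN.
move: Ucells; rewrite E cat_uniq /= !inE !negb_or.
case/and3P=> _ /and3P[hu lu _] /and3P[/andP[_ hv] lv _].
have keep w : (hi, ql) \notin w -> (lo, qr) \notin w ->
    [seq b <- w | b \in boxes N] = [seq b <- w | b \in boxes M].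
  move=> hw lw; apply: eq_in_filter => b bw; rewrite bE in_setU1 in_setD1.
  have [bE'|_] := eqVneq b (hi, ql); first by rewrite -bE' bw in hw.
  by have [bE'|_] := eqVneq b (lo, qr); first by rewrite -bE' bw in lw.
by rewrite !keep.
Qed.

End Block.

(** * Arrows of the crystal as slides at an unmatched letter *)

Section Slide.
Variables (n : nat) (lam : n.-tuple nat) (i : 'I_n.-1).
Let s := ncols lam.
Let lo := row_lo i.
Let hi := row_hi i.
Implicit Types M N : ice n s.

Lemma is_LR (b : 'I_n * 'I_s) : is_L i b -> is_R i b = false.
Proof. by rewrite /is_L /is_R => /eqP->; rewrite eq_sym hi_lo. Qed.

Lemma signature_LR M : all (fun b => is_L i b || is_R i b) (signature i M).
Proof. by apply/allP => b /mem_signature/andP[]. Qed.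

(** Favours neither operator: between states, [f_ice] taking [M] to [N] and [e_ice] taking [N] to
    [M] both amount to it. *)
Variant operator_step M N : Prop :=
  OperatorStep (ql qr : 'I_s) u v of qr = ql.+1 :> nat & slide i ql qr M N &
    signature i M = u ++ (lo, qr) :: v & signature i N = u ++ (hi, ql) :: v &
    pivot (is_L i) (is_R i) u v.

Lemma operator_step_f M N : operator_step M N -> f_ice i M = Some N.
Proof.
case=> ql qr u v qrE [_ NE] SM _ uv; rewrite /f_ice /reduced_signature SM.
have [-> _] := filter_reduce_pivot is_LR (lo, qr) uv.
by rewrite /= /is_L /= eqxx /= qrE /= NE.
Qed.

Lemma operator_step_e M N : operator_step M N -> e_ice i N = Some M.
Proof.
case=> ql qr u v qrE [SgM NE] _ SN uv; rewrite /e_ice /reduced_signature SN.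
have [_ ->] := filter_reduce_pivot is_LR (hi, ql) uv.
by rewrite /= /is_R /= eqxx rev_cat /= NE (set_blockK qrE).
Qed.

Lemma f_operator_step M N : ice_state M -> ice_state N ->
  f_ice i M = Some N -> operator_step M N.
Proof.
move=> IM IN; rewrite /f_ice.
case E: [seq b <- _ | _] => [|[p qr] t] //= [NE].
have [u [v [SM uv]]] := first_L_pivot is_LR (signature_LR M) E.
have : (p, qr) \in [seq b <- reduced_signature i M | is_L i b].
  by rewrite E mem_head.
rewrite mem_filter /is_L /= => /andP[/eqP pE _]; rewrite {p}pE -/lo in SM E.
have /mem_signature/andP[box _] : (lo, qr) \in signature i M.
  by rewrite SM mem_cat mem_head orbT.
(* A box has left sign -, whereas the left boundary carries +. *)
have qr_gt0 : 0 < qr.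
  rewrite lt0n; apply/negP => /eqP q0.
  case/and5P: IM => _ _ /forallP/(_ lo) + _ _.
  suff -> : M.2 (lo, ord0) = left_sign M lo qr.
    by move: box; rewrite inE => /eqP[_ ->].
  by congr (M.2 (lo, _)); apply: val_inj.
have lt_ql : qr.-1 < s by rewrite prednK // ltnW.
pose ql : 'I_s := Ordinal lt_ql.
have qrE : qr = ql.+1 :> nat by rewrite /= prednK.
have [FM FN] : five_vertex M /\ five_vertex N by case/andP: IM; case/andP: IN.
have MN : slide i ql qr M N by apply: slide_lower.
have [u' [v' [SM' SN]]] := signature_slide qrE FM FN MN.
(* As no box is repeated, the cut at [(lo, qr)] is unique and the two decompositions coincide. *)
have := signature_uniq i M; rewrite SM => U.
have /eqP := SM'; rewrite SM uniq_eqseq_pivotl // => /andP[/eqP uE /eqP vE].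
by apply: (OperatorStep qrE MN SM _ uv); rewrite uE vE.
Qed.

Lemma e_operator_step M N : ice_state M -> ice_state N ->
  e_ice i N = Some M -> operator_step M N.
Proof.
move=> IM IN; rewrite /e_ice.
case E: (rev _) => [|[p ql] t] //= [ME].
have [u [v [SN uv]]] := last_R_pivot is_LR (signature_LR N) E.
have : (p, ql) \in [seq b <- reduced_signature i N | is_R i b].
  by rewrite -mem_rev E mem_head.
rewrite mem_filter /is_R /= => /andP[/eqP pE _]; rewrite {p}pE -/hi in SN E.
have /mem_signature/andP[box _] : (hi, ql) \in signature i N.
  by rewrite SN mem_cat mem_head orbT.
(* In the last column the change would put a + on the right boundary of [M]. *)
have lt_qr : ql.+1 < s.
  rewrite ltn_neqAle ltn_ord andbT; apply/negP => /eqP qs.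
  case/and5P: IM => _ _ _ _ /forallP/(_ hi).
  by rewrite -ME ffunE /= ifT ?qs // eqxx.
pose qr : 'I_s := Ordinal lt_qr; have qrE : qr = ql.+1 :> nat by [].
have [FM FN] : five_vertex M /\ five_vertex N by case/andP: IM; case/andP: IN.
have MN : slide i ql qr M N by apply: slide_raise.
have [u' [v' [SM SN']]] := signature_slide qrE FM FN MN.
have := signature_uniq i N; rewrite SN => U.
have /eqP := SN'; rewrite SN uniq_eqseq_pivotl // => /andP[/eqP uE /eqP vE].
by apply: (OperatorStep qrE MN _ SN uv); rewrite uE vE.
Qed.

Definition eps_ice M := count (is_R i) (reduced_signature i M).
Definition phi_ice M := count (is_L i) (reduced_signature i M).

(** At a pivot the two sides reduce as before, so exactly one surviving L becomes a surviving R. *)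
Lemma operator_step_count M N : operator_step M N ->
  eps_ice N = (eps_ice M).+1 /\ phi_ice M = (phi_ice N).+1.
Proof.
case=> ql qr u v _ _ SM SN uv.
rewrite /eps_ice /phi_ice /reduced_signature SM SN -!size_filter.
have [-> ->] := filter_reduce_pivot is_LR (lo, qr) uv.
have [-> ->] := filter_reduce_pivot is_LR (hi, ql) uv.
rewrite /= /is_L /is_R /= !eqxx [lo == _]eq_sym hi_lo /= !cats0 size_cat /=.
by rewrite addn1.
Qed.

Lemma f_ice_None M : f_ice i M = None -> phi_ice M = 0.
Proof. by rewrite /f_ice /phi_ice -size_filter; case: (filter _ _). Qed.

Lemma e_ice_None M : e_ice i M = None -> eps_ice M = 0.
Proof.
rewrite /e_ice /eps_ice -size_filter -size_rev.
by case: (rev _).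
Qed.

(** * Weights and coroots *)

Local Open Scope ring_scope.

(** Grouping the boxes by rows; moving one box then exchanges one summand. *)
Lemma wt_iceE M : wt_ice M = \sum_(b in boxes M) epsilon b.1.
Proof.
rewrite (partition_big fst xpredT) //=; apply: eq_bigr => p _.
rewrite -sumr_const; apply: eq_big => [b|b]; rewrite !inE //.
by case/andP=> _ /eqP->.
Qed.

Lemma wt_operator_step M N : five_vertex M -> five_vertex N ->
  operator_step M N -> wt_ice N = wt_ice M - alpha i.
Proof.
move=> FM FN [ql qr _ _ qrE MN _ _ _].
have [box nbox bE] := boxes_slide qrE FM FN MN.
rewrite !wt_iceE bE big_setU1 /=; last by rewrite in_setD1 negb_and nbox orbT.
rewrite [in RHS](big_setD1 _ box) /= /alpha -/lo -/hi.
by rewrite opprB [RHS]addrC addrA subrK.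
Qed.

(** Cancellation preserves the number of L's minus that of R's, which in the whole signature is the
    number of boxes in row [lo] minus that in row [hi]. *)
Lemma coroot_wt_ice M :
  (phi_ice M)%:Z = (eps_ice M)%:Z + coroot i (wt_ice M).
Proof.
have E : (phi_ice M + count (is_R i) (signature i M) =
    count (is_L i) (signature i M) + eps_ice M)%N.
  exact: (count_reduce is_LR).
suff -> : coroot i (wt_ice M) =
    (count (is_L i) (signature i M))%:Z - (count (is_R i) (signature i M))%:Z.
  by lia.
(* The sum is lifted to an integer vector, on which [coroot_pi] computes the coroot. *)
have -> : wt_ice M = \pi_(weight_lattice n)%qT
    (\sum_(b in boxes M) delta_mx 0 b.1 : 'rV[int]_n).
  by rewrite wt_iceE raddf_sum.
rewrite coroot_pi !summxE -sumrB.
transitivity (\sum_(b <- signature i M) ((is_L i b)%:R - (is_R i b)%:R : int)).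
  (* Boxes outside the signature lie in other rows and contribute 0. *)
  rewrite [LHS](bigID (mem (signature i M))) /= [X in _ + X]big1 ?addr0.
    rewrite big_uniq ?signature_uniq //=.
    apply: eq_big => [b|b _].
      by apply/andb_idl => /mem_signature/andP[].
    by rewrite !mxE /is_L /is_R ![b.1 == _]eq_sym.
  move=> [p q] /andP[bM]; rewrite mem_filter bM /= => npq; rewrite !mxE /=.
  have np r : (r \in [:: lo; hi]) -> (r == p) = false.
    move=> rin; apply: contraNF npq => /eqP <-.
    apply/flatten_mapP; exists q; rewrite ?mem_enum //.
    by move: rin; rewrite !inE !xpair_eqE eqxx !andbT.
  by rewrite !np ?inE ?eqxx ?orbT.
have sum_count (a : pred ('I_n * 'I_s)) w :
    \sum_(b <- w) ((a b)%:R : int) = (count a w)%:Z.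
  elim: w => [|b w IH]; first by rewrite big_nil.
  by rewrite big_cons IH /= PoszD; case: (a b).
by rewrite sumrB !sum_count.
Qed.

End Slide.

(** * Transfer to the type of states, and the crystal axioms *)

Section States.
Variables (n : nat) (lam : n.-tuple nat) (i : 'I_n.-1).
Implicit Types M N : ice_states lam.

Lemma f_opP M N : f_op i M = Some N <-> operator_step i (val M) (val N).
Proof.
split=> [E|/operator_step_f E].
  by apply: f_operator_step; rewrite ?(valP M) ?(valP N) // -val_f_op E.
by have := val_f_op i M; rewrite E; case: (f_op i M) => // N' /= [] /val_inj ->.
Qed.

Lemma e_opP M N : e_op i N = Some M <-> operator_step i (val M) (val N).
Proof.
split=> [E|/operator_step_e E].
  by apply: e_operator_step; rewrite ?(valP M) ?(valP N) // -val_e_op E.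
by have := val_e_op i N; rewrite E; case: (e_op i N) => // N' /= [] /val_inj ->.
Qed.

End States.

Theorem proposition3p12 (n : nat) (lam : n.-tuple nat)
    (hn : 0 < n) (hlam : is_partition lam) :
  exists eps phi : 'I_n.-1 -> ice_states lam -> nat,
    semiregular_crystal (@wt n lam) (@e_op n lam) (@f_op n lam) eps phi.
Proof.
have wtP i M N : operator_step i (val M) (val N) ->
    (@wt n lam N = @wt n lam M - alpha i)%R.
  by apply: wt_operator_step; [case/andP: (valP M) | case/andP: (valP N)].
exists (fun i M => eps_ice i (val M)), (fun i M => phi_ice i (val M)); split.
- move=> i; apply: max_power_count => M.
    by move=> E; apply: e_ice_None; rewrite -val_e_op E.
  by move=> N /e_opP/operator_step_count[].
- move=> i; apply: max_power_count => M.
    by move=> E; apply: f_ice_None; rewrite -val_f_op E.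
  by move=> N /f_opP/operator_step_count[].
- by move=> i M; apply: coroot_wt_ice.
(* An arrow of [e_op] is a reversed arrow of [f_op], so C2 is C3 read backwards. *)
- by move=> i M N /e_opP/wtP->; rewrite subrK.
- by move=> i M N /f_opP/wtP.
- by move=> i M N /e_opP/operator_step_count[-> ->]; lia.
- by move=> i M N /f_opP/operator_step_count[-> ->]; lia.
- by move=> i M N; rewrite f_opP e_opP.
Qed.
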